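(* Let $a_1,\dots,a_m\in\mathbb{R}^d$ and $b=(b_1,\dots,b_m)^{\mathrm T}\in\mathbb{R}^m$, and define on $\mathbb{R}^d$ $$f_1(x)=\frac14\sum_{r=1}^m\langle a_r,x\rangle^4+\frac14\|b\|^2,\qquad h(x)=\frac14\|x\|^4 .$$ Then, for any $L>0$ satisfying $$L\ge 3\left\|\sum_{r=1}^m\|a_r\|^2a_ra_r^{\mathrm T}\right\|,$$ the function $Lh-f_1$ is convex on $\mathbb{R}^d$. Therefore, the pair $(f_1,h)$ is $L$-smad on $\mathbb{R}^d$.
   Context: For vectors $\|\cdot\|$ is the Euclidean norm; for matrices it is the operator (spectral) norm. $L$-smad on $\mathbb{R}^d$: a pair $(f,h)$ is $L$-smooth adaptable ($L$-smad) on $C=\mathbb{R}^d$, $L>0$, if $h$ is a kernel generating distance (proper, lower semicontinuous, convex, with $\operatorname{dom} h\subset\overline{C}$, $\operatorname{dom}\partial h=C$, and $\mathcal{C}^1$ on $\operatorname{int}\operatorname{dom} h=C$), $f$ is proper and lower semicontinuous with $\operatorname{dom} h\subset\operatorname{dom} f$ and $\mathcal{C}^1$ on $C$, and both $Lh-f$ and $Lh+f$ are convex on $C$. *)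

(* Defs.v *)
From mathcomp Require Import all_boot all_order all_algebra.
From mathcomp Require Import all_classical all_reals all_analysis.
Import Order.TTheory GRing.Theory Num.Theory.
Import numFieldNormedType.Exports.

Set Implicit Arguments.
Unset Strict Implicit.
Unset Printing Implicit Defensive.

Local Open Scope classical_set_scope.
Local Open Scope ring_scope.

Section Euclidean.
Context {R : realType}.

Definition inner {d : nat} (x y : 'cV[R]_d) : R := (x^T *m y) 0 0.

(* The library norm `|x| on matrices is the max norm: it induces the usual
   topology and notion of differentiability, but it is neither the Euclidean
   nor the operator norm. *)
Definition enorm {d : nat} (x : 'cV[R]_d) : R := Num.sqrt (inner x x).

Definition opnorm {m n : nat} (A : 'M[R]_(m, n)) : R :=
  sup [set enorm (A *m x) | x in [set x : 'cV[R]_n | enorm x <= 1]].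

Definition grad {d : nat} (f : 'cV[R]_d -> R) (x : 'cV[R]_d) : 'cV[R]_d :=
  \col_(i < d) 'd f x (delta_mx i 0).

(* Intended for open U. *)
Definition C1_on {d : nat} (U : set 'cV[R]_d) (f : 'cV[R]_d -> R) : Prop :=
  (forall x, U x -> differentiable f x) /\ {within U, continuous (grad f)}.

End Euclidean.

Section ExtendedFunctions.
Context {R : realType} {d : nat}.
Implicit Types f h : 'cV[R]_d -> \bar R.

Definition edom f : set 'cV[R]_d := [set x | (f x < +oo)%E].

Definition proper_fun f : Prop :=
  (forall x, (-oo < f x)%E) /\ edom f !=set0.

(* Meant for functions that never take the value -oo, so that the right-hand
   side is never of the form +oo - oo. *)
Definition convex_efun f : Prop :=
  forall (x y : 'cV[R]_d) (t : R), 0 < t < 1 ->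
    (f (t *: x + (1 - t) *: y)%R <= t%:E * f x + (1 - t)%R%:E * f y)%E.

Definition subdiff f (x : 'cV[R]_d) : set 'cV[R]_d :=
  [set g | f x \is a fin_num /\
           forall y, (f x + (inner g (y - x)%R)%:E <= f y)%E].

Definition dom_subdiff f : set 'cV[R]_d := [set x | subdiff f x !=set0].

Record kernel_generating_distance (C : set 'cV[R]_d) h : Prop := {
  kgd_proper : proper_fun h ;
  kgd_lsc : lower_semicontinuous h ;
  kgd_convex : convex_efun h ;
  kgd_dom : edom h `<=` closure C ;
  kgd_dom_subdiff : dom_subdiff h = C ;
  kgd_interior : interior (edom h) = C ;
  kgd_C1 : C1_on (interior (edom h)) (fine \o h)
}.

(* h and f are finite on C = interior (edom h), so passing to real-valued
   functions with fine loses nothing there. *)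
Record smad (C : set 'cV[R]_d) (L : R) f h : Prop := {
  smad_gt0 : 0 < L ;
  smad_kernel : kernel_generating_distance C h ;
  smad_proper : proper_fun f ;
  smad_lsc : lower_semicontinuous f ;
  smad_dom : edom h `<=` edom f ;
  smad_C1 : C1_on C (fine \o f) ;
  smad_convexB : convex_function C (fun x => L * fine (h x) - fine (f x)) ;
  smad_convexD : convex_function C (fun x => L * fine (h x) + fine (f x))
}.

End ExtendedFunctions.

(* Main.v *)
(* The Hessian of L h - f1 at x along v is
     L (|x|^2 |v|^2 + 2 <x, v>^2) - 3 sum_r <a_r, x>^2 <a_r, v>^2.
   By Cauchy-Schwarz, <a_r, x>^2 <= |a_r|^2 |x|^2, so the sum is at most
   |x|^2 <v, M v> <= opnorm M |x|^2 |v|^2 with M = sum_r |a_r|^2 a_r a_r^T, and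
   the Hessian is nonnegative. Convexity follows from its nonnegativity by an
   exact algebraic formula for the Jensen gap of a quartic. *)

Require Import Defs.
From HB Require Import structures.
From mathcomp Require Import all_boot all_order all_algebra.
From mathcomp Require Import all_classical all_reals all_analysis.
From mathcomp Require Import ring lra.
Import Order.TTheory GRing.Theory Num.Theory.
Import numFieldNormedType.Exports.

Local Open Scope classical_set_scope.
Local Open Scope ring_scope.

(** * Inner product, Cauchy-Schwarz and the operator norm *)

Section Inner.
Context {R : realType}.

Lemma innerE {d} (x y : 'cV[R]_d) : inner x y = \sum_i x i 0 * y i 0.
Proof. by rewrite /inner mxE; apply: eq_bigr => i _; rewrite mxE. Qed.

Lemma innerC {d} (x y : 'cV[R]_d) : inner x y = inner y x.
Proof. by rewrite !innerE; apply: eq_bigr => i _; rewrite mulrC. Qed.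

Lemma innerDr {d} (x y z : 'cV[R]_d) : inner x (y + z) = inner x y + inner x z.
Proof. by rewrite /inner mulmxDr mxE. Qed.

Lemma innerZr {d} (k : R) (x y : 'cV[R]_d) : inner x (k *: y) = k * inner x y.
Proof. by rewrite /inner -scalemxAr mxE. Qed.

Lemma innerDl {d} (x y z : 'cV[R]_d) : inner (x + y) z = inner x z + inner y z.
Proof. by rewrite innerC innerDr !(innerC z). Qed.

Lemma innerZl {d} (k : R) (x y : 'cV[R]_d) : inner (k *: x) y = k * inner x y.
Proof. by rewrite innerC innerZr innerC. Qed.

Lemma innerBr {d} (x y z : 'cV[R]_d) : inner x (y - z) = inner x y - inner x z.
Proof. by rewrite innerDr -scaleN1r innerZr mulN1r. Qed.

Lemma innerBl {d} (x y z : 'cV[R]_d) : inner (x - y) z = inner x z - inner y z.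
Proof. by rewrite innerC innerBr !(innerC z). Qed.

Lemma inner0r {d} (x : 'cV[R]_d) : inner x 0 = 0.
Proof. by rewrite -(scale0r 0) innerZr mul0r. Qed.

Lemma inner_sumr {d m} (x : 'cV[R]_d) (F : 'I_m -> 'cV[R]_d) :
  inner x (\sum_r F r) = \sum_r inner x (F r).
Proof. by rewrite /inner mulmx_sumr summxE. Qed.

Lemma inner_ge0 {d} (x : 'cV[R]_d) : 0 <= inner x x.
Proof. by rewrite innerE; apply: sumr_ge0 => i _; rewrite -expr2 sqr_ge0. Qed.

Lemma inner_eq0 {d} (x : 'cV[R]_d) : inner x x = 0 -> x = 0.
Proof.
rewrite innerE => /psumr_eq0P x0; apply/colP => i; rewrite mxE.
by apply/eqP; rewrite -sqrf_eq0 expr2 x0 // => j _; rewrite -expr2 sqr_ge0.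
Qed.

Lemma Cauchy_Schwarz {d} (x y : 'cV[R]_d) :
  inner x y ^+ 2 <= inner x x * inner y y.
Proof.
have [/inner_eq0 ->|y0] := eqVneq (inner y y) 0.
  by rewrite !inner0r mulr0 expr0n.
(* This squared norm equals |y|^2 (|x|^2 |y|^2 - <x, y>^2), and |y|^2 can be cancelled once it is
   positive. *)
have : 0 <= inner (inner y y *: x - inner x y *: y)
                  (inner y y *: x - inner x y *: y) by exact: inner_ge0.
rewrite !(innerBr, innerBl, innerZr, innerZl) (innerC y x).
have {}y0 : 0 < inner y y by rewrite lt_def y0 inner_ge0.
by move=> h; rewrite -subr_ge0 -(pmulr_rge0 (_ - _) y0); lra.
Qed.

Lemma enorm_ge0 {d} (x : 'cV[R]_d) : 0 <= enorm x.
Proof. exact: sqrtr_ge0. Qed.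

Lemma enorm2 {d} (x : 'cV[R]_d) : enorm x ^+ 2 = inner x x.
Proof. by rewrite sqr_sqrtr ?inner_ge0. Qed.

Lemma enorm4 {d} (x : 'cV[R]_d) : enorm x ^+ 4 = inner x x ^+ 2.
Proof. by rewrite -enorm2 -exprM. Qed.

Lemma enormZ {d} (k : R) (x : 'cV[R]_d) : enorm (k *: x) = `|k| * enorm x.
Proof.
by rewrite /enorm innerZl innerZr mulrA -expr2 sqrtrM ?sqr_ge0 // sqrtr_sqr.
Qed.

Lemma inner_le_enorm {d} (x y : 'cV[R]_d) : inner x y <= enorm x * enorm y.
Proof.
rewrite -sqrtrM ?inner_ge0 //; apply: le_trans (ler_norm _) _.
by rewrite -sqrtr_sqr ler_wsqrtr // Cauchy_Schwarz.
Qed.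

Lemma mulmx_inner {m n} (A : 'M[R]_(m, n)) (x : 'cV[R]_n) i :
  (A *m x) i 0 = inner (row i A)^T x.
Proof. by rewrite mxE innerE; apply: eq_bigr => j _; rewrite !mxE. Qed.

(** The real [sup] is a least upper bound only for nonempty bounded sets. The bound used is the
    Frobenius norm of [A], by Cauchy-Schwarz on each row. *)
Lemma opnorm_has_sup {m n} (A : 'M[R]_(m, n)) :
  has_sup [set enorm (A *m x) | x in [set x : 'cV[R]_n | enorm x <= 1]].
Proof.
split.
  exists (enorm (A *m 0)), 0 => //=.
  by rewrite /enorm inner0r sqrtr0.
exists (Num.sqrt (\sum_i inner (row i A)^T (row i A)^T)) => _ [x /= x1 <-].
apply: ler_wsqrtr; rewrite innerE; apply: ler_sum => i _.
rewrite mulmx_inner -expr2; apply: le_trans (Cauchy_Schwarz _ _) _.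
by rewrite ler_piMr ?inner_ge0 // -enorm2 expr_le1 ?enorm_ge0.
Qed.

Lemma enorm_mulmx_le {m n} (A : 'M[R]_(m, n)) (x : 'cV[R]_n) :
  enorm (A *m x) <= opnorm A * enorm x.
Proof.
have [x0|x0] := eqVneq (enorm x) 0.
  have -> : x = 0 by apply: inner_eq0; rewrite -enorm2 x0 expr0n.
  by rewrite mulmx0 /enorm !inner0r sqrtr0 mulr0.
have {}x0 : 0 < enorm x by rewrite lt_def x0 enorm_ge0.
rewrite -ler_pdivrMr //.
apply: (sup_upper_bound (opnorm_has_sup A)).
exists ((enorm x)^-1 *: x).
  by rewrite /= enormZ gtr0_norm ?invr_gt0 // mulVf // gt_eqF.
by rewrite -scalemxAr enormZ gtr0_norm ?invr_gt0 // mulrC.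
Qed.

Lemma inner_mulmx_le {n} (A : 'M[R]_n) (x : 'cV[R]_n) :
  inner x (A *m x) <= opnorm A * inner x x.
Proof.
apply: le_trans (inner_le_enorm _ _) _.
rewrite -enorm2 expr2 mulrCA ler_wpM2l ?enorm_ge0 //; exact: enorm_mulmx_le.
Qed.

End Inner.

(** * Convexity of quartics through their Hessians *)

Section QuarticConvexity.
Context {R : realType} {d : nat}.
Implicit Types (g : 'cV[R]_d -> R) (H : 'cV[R]_d -> 'cV[R]_d -> R).

(* For g a quartic form plus a constant, with Hessian H x v = D^2 g(x)[v, v],
   the second derivative of g along a segment of direction v is quadratic with
   leading coefficient H v v. The Jensen gap, which is an integral of it, is
   thus given exactly by one node on the segment and a multiple of H v v, both
   with nonnegative weights. *)
Definition quartic_hessian g H := forall (t : R) x y,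
  t * g x + (1 - t) * g y - g (t *: x + (1 - t) *: y) =
  t * (1 - t) * (2^-1 * H (((1 + t) / 3) *: x + ((2 - t) / 3) *: y) (x - y)
                 + (1 - t + t ^+ 2) / 36 * H (x - y) (x - y)).

Lemma quartic_hessianD g1 g2 H1 H2 :
  quartic_hessian g1 H1 -> quartic_hessian g2 H2 ->
  quartic_hessian (fun x => g1 x + g2 x) (fun x v => H1 x v + H2 x v).
Proof. by move=> g1H g2H t x y; have := (g1H t x y, g2H t x y) => -[]; lra. Qed.

(** The scalar may have any sign: with -1 it handles the difference L h - f1. *)
Lemma quartic_hessianZ k g H :
  quartic_hessian g H ->
  quartic_hessian (fun x => k * g x) (fun x v => k * H x v).
Proof. by move=> gH t x y; have := congr1 ( *%R k) (gH t x y); lra. Qed.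

Lemma quartic_hessian_cst k : quartic_hessian (fun=> k) (fun _ _ => 0).
Proof. by move=> t x y; ring. Qed.

Lemma quartic_hessian_sum n (G : 'I_n -> 'cV[R]_d -> R) (H : 'I_n -> _) :
  (forall r, quartic_hessian (G r) (H r)) ->
  quartic_hessian (fun x => \sum_r G r x) (fun x v => \sum_r H r x v).
Proof.
move=> GH t x y; rewrite !mulr_sumr -!big_split -sumrB mulr_sumr.
by apply: eq_bigr => r _; exact: GH.
Qed.

(** Along a line [inner a] is affine, so this is the fourth power of one real variable, with second
    derivative 12 s^2. *)
Lemma quartic_hessian_inner4 (a : 'cV[R]_d) :
  quartic_hessian (fun x => inner a x ^+ 4)
    (fun x v => 12 * (inner a x ^+ 2 * inner a v ^+ 2)).
Proof. by move=> t x y; rewrite !(innerBr, innerDr, innerZr); field. Qed.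

Lemma quartic_hessian_enorm4 :
  quartic_hessian (fun x => enorm x ^+ 4)
    (fun x v => 4 * (inner x x * inner v v + 2 * inner x v ^+ 2)).
Proof.
move=> t x y; rewrite !enorm4.
(* Only a polynomial identity in t, <x, x>, <x, y> and <y, y> remains. *)
rewrite !(innerBr, innerBl, innerDr, innerDl, innerZr, innerZl) (innerC y x).
by field.
Qed.

Lemma enorm4_hessian_ge0 (x v : 'cV[R]_d) :
  0 <= 4 * (inner x x * inner v v + 2 * inner x v ^+ 2).
Proof.
rewrite mulr_ge0 ?ler0n // addr_ge0 //.
  by rewrite mulr_ge0 ?inner_ge0.
by rewrite mulr_ge0 ?sqr_ge0.
Qed.

Lemma quartic_hessian_convex g H (t : R) x y :
  quartic_hessian g H -> (forall z v, 0 <= H z v) -> 0 <= t <= 1 ->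
  g (t *: x + (1 - t) *: y) <= t * g x + (1 - t) * g y.
Proof.
move=> gH H0 /andP[t0 t1]; rewrite -subr_ge0 gH.
rewrite mulr_ge0 ?mulr_ge0 ?subr_ge0 // addr_ge0 ?mulr_ge0 //.
(* The remaining sign is that of the weight 1 - t + t^2, a sum of the nonnegative terms 1 - t and
   t^2. *)
by nra.
Qed.

Lemma quartic_hessian_convex_function g H :
  quartic_hessian g H -> (forall z v, 0 <= H z v) ->
  convex_function [set: 'cV[R]_d] g.
Proof.
move=> gH H0 t x y _ _; rewrite convRE.
have t01 : 0 <= t%:num <= 1 by rewrite ge0 le1.
exact: (quartic_hessian_convex _ _ _ _ _ gH H0 t01).
Qed.

End QuarticConvexity.

(** * Continuous differentiability, semicontinuity and properness *)

Section C1.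
Context {R : realType} {d : nat}.
Implicit Types f g : 'cV[R]_d -> R.

(* On the whole space, continuity of the gradient is continuity of every
   directional derivative; this form is stable under products without
   splitting into coordinates. *)
Definition C1 f := (forall x, differentiable f x) /\
  forall v, continuous (fun x => 'd f x v).

Lemma C1_on_setT f : C1 f -> C1_on setT f.
Proof.
move=> [df cf]; split=> //; apply: continuous_subspaceT.
(* In the standard basis the gradient is a finite sum of directional derivatives times fixed
   vectors. *)
have -> : grad f =
    fun x => \sum_i 'd f x (delta_mx i 0) *: (delta_mx i 0 : 'cV[R]_d).
  apply/funext => z; rewrite [LHS]matrix_sum_delta; apply: eq_bigr => i _.
  by rewrite big_ord1 mxE.
apply: continuous_big => [|i _ x]; first exact: add_continuous.
apply: cvgZr_tmp; first exact: nbhs_filter.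
exact: cf.
Qed.

Lemma C1_continuous f : C1 f -> continuous f.
Proof. by move=> [df _] x; exact: differentiable_continuous. Qed.

Lemma C1_cst k : C1 (fun=> k).
Proof.
split=> [x|v x]; first exact: differentiable_cst.
rewrite (_ : (fun _ => _) = cst 0); first exact: cst_continuous.
by apply/funext => z; rewrite (diff_cst k).
Qed.

Lemma C1D f g : C1 f -> C1 g -> C1 (fun x => f x + g x).
Proof.
move=> [df cf] [dg cg]; split=> [x|v x]; first exact: differentiableD.
rewrite (_ : (fun _ => _) = fun x => 'd f x v + 'd g x v); last first.
  by apply/funext => z; rewrite diffD.
exact: (continuousD (cf v x) (cg v x)).
Qed.

Lemma C1M f g : C1 f -> C1 g -> C1 (fun x => f x * g x).
Proof.
move=> Cf Cg; have [df cf] := Cf; have [dg cg] := Cg.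
split=> [x|v x]; first exact: differentiableM.
rewrite [X in continuous_at _ X](_ : _ =
    fun x => f x * 'd g x v + g x * 'd f x v).
  exact: (continuousD (continuousM (C1_continuous _ Cf x) (cg v x))
                      (continuousM (C1_continuous _ Cg x) (cf v x))).
by apply/funext => z; rewrite (diffM (df z) (dg z)).
Qed.

Lemma C1X f n : C1 f -> C1 (fun x => f x ^+ n).
Proof.
move=> Cf; elim: n => [|n IHn]; first exact: C1_cst.
by under eq_fun do rewrite exprS; exact: C1M.
Qed.

Lemma C1_sum n (F : 'I_n -> 'cV[R]_d -> R) :
  (forall r, C1 (F r)) -> C1 (fun x => \sum_r F r x).
Proof.
elim: n F => [|n IHn] F CF.
  by under eq_fun do rewrite big_ord0; exact: C1_cst.
under eq_fun do rewrite big_ord_recl.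
by apply: C1D => //; exact: IHn.
Qed.

Lemma C1_coord i : C1 (fun x => x i 0).
Proof.
split=> [x|v x]; first exact: differentiable_coord.
(* A coordinate is linear, hence its own differential at every point, so its derivative along [v] is
   constant in the base point. *)
pose c := fun x : 'cV[R]_d => x i 0.
have lin_c : linear c by move=> k y z; rewrite /c !mxE.
pose cL := GRing.isLinear.Build _ _ _ _ _ lin_c.
pose f : {linear 'cV[R]_d -> R} := HB.pack c cL.
rewrite (_ : (fun _ => _) = cst (f v)); first exact: cst_continuous.
by apply/funext => z; rewrite (diff_lin (f := f)) //; exact: coord_continuous.
Qed.

Lemma C1_inner (a : 'cV[R]_d) : C1 (inner a).
Proof.
rewrite (_ : inner a = fun x => \sum_i a i 0 * x i 0); last first.
  by apply/funext => x; exact: innerE.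
by apply: C1_sum => i; apply: C1M; [exact: C1_cst|exact: C1_coord].
Qed.

(** The norm need not be differentiable at the origin, but its fourth power is the square of the
    polynomial <x, x>. *)
Lemma C1_enorm4 : C1 (fun x : 'cV[R]_d => enorm x ^+ 4).
Proof.
under eq_fun do rewrite enorm4 innerE.
by apply: C1X; apply: C1_sum => i; apply: C1M; exact: C1_coord.
Qed.

Lemma continuous_lsc f : continuous f -> lower_semicontinuous (EFin \o f).
Proof.
move=> cf x a; rewrite lte_fin => afx.
exists [set y | a < f y] => [|y /=]; last by rewrite lte_fin.
exact: (cf x _ (lt_nbhsr afx)).
Qed.

Lemma edom_EFin f : edom (EFin \o f) = setT.
Proof. by apply/seteqP; split=> // x _ /=; rewrite /edom /= ltry. Qed.

Lemma proper_EFin f : proper_fun (EFin \o f).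
Proof. by split=> [x|]; [exact: ltNyr|rewrite edom_EFin; exists 0]. Qed.

End C1.

(** * The kernel |x|^4 / 4 and its subgradient |x|^2 x *)

Lemma enorm4_subgradient (R : realType) (d : nat) (x y : 'cV[R]_d) :
  4^-1 * enorm x ^+ 4 + inner (inner x x *: x) (y - x) <= 4^-1 * enorm y ^+ 4.
Proof.
rewrite !enorm4 innerZl innerBr.
(* The slack in the inequality is (|x|^2 - |y|^2)^2 / 4 + |x|^2 |x - y|^2 / 2. *)
have : 0 <= inner (x - y) (x - y) by exact: inner_ge0.
rewrite !(innerBr, innerBl) (innerC y x) => h.
have := inner_ge0 x; have := sqr_ge0 (inner x x - inner y y).
nra.
Qed.

Lemma kgd_enorm4 (R : realType) (d : nat) :
  kernel_generating_distance setT
    (EFin \o (fun x : 'cV[R]_d => 4^-1 * enorm x ^+ 4)).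
Proof.
have C1h : C1 (fun x : 'cV[R]_d => 4^-1 * enorm x ^+ 4).
  exact: C1M (C1_cst _) C1_enorm4.
have hess := quartic_hessianZ 4^-1 _ _ (@quartic_hessian_enorm4 R d).
split.
- exact: proper_EFin.
- exact/continuous_lsc/C1_continuous.
- move=> x y t /andP[t0 t1]; rewrite /= -!EFinM -EFinD lee_fin.
  apply: (quartic_hessian_convex _ _ _ _ _ hess) => [z v|].
    by rewrite mulr_ge0 ?invr_ge0 // enorm4_hessian_ge0.
  by rewrite !ltW.
- by rewrite closureT.
- apply/seteqP; split=> // x _; exists (inner x x *: x).
  by split=> // y; rewrite /= -EFinD lee_fin enorm4_subgradient.
- by rewrite edom_EFin interiorT.
- by rewrite edom_EFin interiorT; exact: C1_on_setT.
Qed.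

(** * The operator norm bound on the Hessian of f1, and the theorem *)

Lemma sum_inner_sqr_le (R : realType) (d m : nat) (a : 'I_m -> 'cV[R]_d)
    (x v : 'cV[R]_d) :
  \sum_r inner (a r) x ^+ 2 * inner (a r) v ^+ 2 <=
  opnorm (\sum_r enorm (a r) ^+ 2 *: (a r *m (a r)^T)) *
    (inner x x * inner v v).
Proof.
set M := \sum_r _ *: _.
apply: (@le_trans _ _ (inner x x * inner v (M *m v))); last first.
  by rewrite mulrCA ler_wpM2l ?inner_ge0 ?inner_mulmx_le.
rewrite mulmx_suml inner_sumr mulr_sumr; apply: ler_sum => r _.
have -> : inner v ((enorm (a r) ^+ 2 *: (a r *m (a r)^T)) *m v) =
    inner (a r) (a r) * inner (a r) v ^+ 2.
  rewrite enorm2 -scalemxAl innerZr -mulmxA.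
  (* The 1 x 1 matrix [(a r)^T *m v] acts as the scalar <a_r, v>. *)
  have -> : a r *m ((a r)^T *m v) = inner (a r) v *: a r.
    by rewrite [(a r)^T *m v]mx11_scalar mul_mx_scalar.
  by rewrite innerZr (innerC v) expr2.
by rewrite mulrA (mulrC (inner x x)) ler_wpM2r ?sqr_ge0 ?Cauchy_Schwarz.
Qed.

Theorem proposition5 (R : realType) (d m : nat)
    (a : 'I_m -> 'cV[R]_d) (b : 'cV[R]_m) :
  let f1 : 'cV[R]_d -> R := fun x =>
    4^-1 * (\sum_(r < m) inner (a r) x ^+ 4) + 4^-1 * enorm b ^+ 2 in
  let h : 'cV[R]_d -> R := fun x => 4^-1 * enorm x ^+ 4 in
  forall L : R,
    0 < L ->
    3 * opnorm (\sum_(r < m) enorm (a r) ^+ 2 *: (a r *m (a r)^T)) <= L ->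
    convex_function [set: 'cV[R]_d] (fun x => L * h x - f1 x) /\
    smad [set: 'cV[R]_d] L (EFin \o f1) (EFin \o h).
Proof.
move=> f1 h L L0 ML.
have C1f : C1 f1.
  apply: C1D; last exact: C1_cst.
  by apply: C1M; [exact: C1_cst|apply: C1_sum => r; exact/C1X/C1_inner].
have hessh := quartic_hessianZ L _ _
  (quartic_hessianZ 4^-1 _ _ (@quartic_hessian_enorm4 R d)).
have hessf := quartic_hessianD _ _ _ _
  (quartic_hessianZ 4^-1 _ _
    (quartic_hessian_sum _ _ _ (fun r => quartic_hessian_inner4 (a r))))
  (quartic_hessian_cst (4^-1 * enorm b ^+ 2)).
have convB : convex_function [set: 'cV[R]_d] (fun x => L * h x - f1 x).
  have hess := quartic_hessianD _ _ _ _ hessh (quartic_hessianZ (-1) _ _ hessf).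
  rewrite (_ : (fun _ => _) = fun x => L * h x + -1 * f1 x); last first.
    by apply/funext => x; rewrite mulN1r.
  apply: (quartic_hessian_convex_function _ _ hess) => z v.
  have := sum_inner_sqr_le _ _ _ a z v; rewrite -mulr_sumr.
  (* The Hessian is L |z|^2 |v|^2 + 2 L <z, v>^2 minus three times the bounded sum; the first term
     dominates the subtracted one. *)
  have : 3 * opnorm (\sum_(r < m) enorm (a r) ^+ 2 *: (a r *m (a r)^T)) *
    (inner z z * inner v v) <= L * (inner z z * inner v v).
    by rewrite ler_wpM2r ?mulr_ge0 ?inner_ge0.
  have : 0 <= L * inner z v ^+ 2 by rewrite mulr_ge0 ?sqr_ge0 ?ltW.
  by lra.
split=> //; split=> //.
- exact: kgd_enorm4.
- exact: proper_EFin.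
- exact/continuous_lsc/C1_continuous.
- by rewrite !edom_EFin.
- exact: C1_on_setT.
(* For L h + f1 both Hessians are nonnegative, that of f1 being 3 sum_r <a_r, z>^2 <a_r, v>^2. *)
- have hess := quartic_hessianD _ _ _ _ hessh hessf.
  apply: (quartic_hessian_convex_function _ _ hess) => z v.
  rewrite addr0 addr_ge0 //.
    by apply/mulr_ge0/mulr_ge0; rewrite ?(ltW L0) ?invr_ge0 ?enorm4_hessian_ge0.
  rewrite mulr_ge0 ?invr_ge0 // sumr_ge0 // => r _.
  by rewrite mulr_ge0 ?ler0n // mulr_ge0 ?sqr_ge0.
Qed.
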